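(* Let $I\subseteq\mathbb{R}$ be an interval, let $h:J\to\mathbb{R}$ with $[0,1]\subseteq J\subseteq\mathbb{R}$ be superadditive and nonnegative with $h(\alpha)\ge\alpha$ for all $\alpha\in(0,1)$, and let $f,g\in SX(h,I)$ be similarly ordered on $I$. Let $a,b\in I$ with $a<b$. Then $$\frac{M(a,b)}{3}+\frac{N(a,b)}{6}\le h(1)\left[f(a)g(a)\int_0^1 h(\alpha)\,d\alpha+f(b)g(b)\int_0^1 h(1-\alpha)\,d\alpha\right].$$
   Context: $SX(h,I)$ denotes the class of $h$-convex functions: $f:I\to\mathbb{R}$ belongs to $SX(h,I)$ if $f$ is nonnegative and $f(tx+(1-t)y)\le h(t)f(x)+h(1-t)f(y)$ for all $x,y\in I$ and $t\in[0,1]$. The function $h:J\to\mathbb{R}$ is superadditive if $h(x+y)\ge h(x)+h(y)$ for all $x,y\in J$ (with $x+y\in J$). Functions $f,g$ are similarly ordered on $I$ if $(f(x)-f(y))(g(x)-g(y))\ge 0$ for all $x,y\in I$. Notation: $M(a,b)=f(a)g(a)+f(b)g(b)$ and $N(a,b)=f(a)g(b)+f(b)g(a)$. *)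

(* Defs.v *)
From mathcomp Require Import all_boot all_order all_algebra.
From mathcomp Require Import all_classical all_reals all_analysis.
Set Implicit Arguments.
Unset Strict Implicit.
Unset Printing Implicit Defensive.
Import Order.TTheory GRing.Theory Num.Theory.
Import numFieldNormedType.Exports.
Local Open Scope classical_set_scope.
Local Open Scope ring_scope.

(* A real function with domain D is a total function on R of which only the
   values on the set D are constrained. *)

Definition SX (R : realType) (h : R -> R) (I : set R) (f : R -> R) : Prop :=
  (forall x, I x -> 0 <= f x) /\
  (forall x y t, I x -> I y -> 0 <= t <= 1 ->
     f (t * x + (1 - t) * y) <= h t * f x + h (1 - t) * f y).

Definition superadditive_on (R : realType) (J : set R) (h : R -> R) : Prop :=
  forall x y, J x -> J y -> J (x + y) -> h x + h y <= h (x + y).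

Definition similarly_ordered (R : realType) (I : set R) (f g : R -> R) : Prop :=
  forall x y, I x -> I y -> 0 <= (f x - f y) * (g x - g y).

Definition prodM (R : realType) (f g : R -> R) (a b : R) : R :=
  f a * g a + f b * g b.

Definition prodN (R : realType) (f g : R -> R) (a b : R) : R :=
  f a * g b + f b * g a.

(* Main.v *)
Require Import Defs.
From mathcomp Require Import all_boot all_order all_algebra.
From mathcomp Require Import all_classical all_reals all_analysis.
From mathcomp Require Import measurable_realfun lra.
Import Order.TTheory GRing.Theory Num.Theory.
Import numFieldNormedType.Exports.
Local Open Scope classical_set_scope.
Local Open Scope ring_scope.

(** Both sides are compared with half of [prodM f g a b].

    On the left, being similarly ordered says exactly that the crossed products
    are dominated by the aligned ones, [prodN f g a b <= prodM f g a b], so the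
    left-hand side is at most [M/3 + M/6 = M/2].

    On the right, superadditivity gives [h 1 >= h (1/2) + h (1/2) >= 1], and
    [h alpha >= alpha] makes each of the two integrals at least
    [1/2], the integral of [alpha] and of [1 - alpha].  Since [f a * g a] and
    [f b * g b] are nonnegative, the right-hand side is at least [M/2].

    Comparing integrals requires [h] to be integrable on the unit interval.
    This is automatic: a nonnegative superadditive function is nondecreasing
    ([superadditive_nondecreasing]), and a function that is nondecreasing on a
    compact interval is measurable and bounded there
    ([nondecreasing_itv_integrable]). *)

(** The increment [h y - h x] is at least [h (y - x)], which is nonnegative
    because [y - x] lies again in the unit interval. *)
Lemma superadditive_nondecreasing {R : realType} (J : set R) (h : R -> R) :
  `[0, 1] `<=` J -> superadditive_on J h -> (forall x, J x -> 0 <= h x) ->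
  {in `[0, 1] &, {homo h : x y / x <= y}}.
Proof.
move=> hJ hadd h0 x y; rewrite !in_itv/= => /andP[x0 x1] /andP[y0 y1] xy.
have Jx : J x by apply: hJ; rewrite /= in_itv/= x0.
have Jy : J y by apply: hJ; rewrite /= in_itv/= y0.
have Jyx : J (y - x) by apply: hJ; rewrite /= in_itv/=; lra.
have := hadd x (y - x) Jx Jyx; rewrite subrKC => /(_ Jy).
by have := h0 _ Jyx; lra.
Qed.

(** Measurability of monotone functions is known for functions monotone on the
    whole line; precomposing with the clamping of the line to [[a, b]] reduces
    to that case. *)
Lemma nondecreasing_itv_measurable {R : realType} (a b : R) (h : R -> R) :
  a <= b -> {in `[a, b] &, {homo h : x y / x <= y}} ->
  measurable_fun `[a, b] h.
Proof.
move=> ab hnd; pose clamp (x : R) := Num.min b (Num.max a x).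
have clampP x : clamp x \in `[a, b].
  by rewrite in_itv/= /clamp le_min ab le_max lexx ge_min lexx.
have : measurable_fun `[a, b] (h \o clamp).
  apply: nondecreasing_measurable => // x y xy /=.
  apply: hnd; [exact: clampP|exact: clampP|].
  by rewrite /clamp le_min ge_min lexx/= ge_min ge_max !le_max lexx xy/= !orbT.
apply: eq_measurable_fun => x; rewrite inE/= in_itv/= => /andP[ax xb].
by rewrite /clamp max_r// min_r.
Qed.

Lemma nondecreasing_itv_integrable {R : realType} (a b : R) (h : R -> R) :
  a <= b -> {in `[a, b] &, {homo h : x y / x <= y}} ->
  lebesgue_measure.-integrable `[a, b] (EFin \o h).
Proof.
move=> ab hnd; apply: measurable_bounded_integrable => //.
- by rewrite /= lebesgue_measure_itv/=; case: ifP => _; rewrite ?ltry.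
- exact: nondecreasing_itv_measurable.
- exists (`|h a| + `|h b|); split; first exact: num_real.
  move=> M hM x /= xab; apply: le_trans (ltW hM).
  move: (xab); rewrite in_itv/= => /andP[ax xb].
  have ha : h a <= h x by apply: hnd; rewrite // in_itv/= lexx.
  have hb : h x <= h b by apply: hnd; rewrite // in_itv/= lexx andbT.
  have := ler_norm (h b); have := ler_norm (- h a); rewrite normrN.
  have := normr_ge0 (h a); have := normr_ge0 (h b).
  by rewrite ler_norml; move=> *; apply/andP; split; lra.
Qed.

(** Replacing [x] by [1 - x] turns a nondecreasing function into minus a
    nondecreasing one. *)
Lemma nondecreasing_onem_integrable {R : realType} (h : R -> R) :
  {in `[0, 1] &, {homo h : x y / x <= y}} ->
  lebesgue_measure.-integrable `[0, 1] (EFin \o (fun x => h (1 - x))).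
Proof.
move=> hnd.
have : lebesgue_measure.-integrable `[0, 1] (EFin \o (fun x => - h (1 - x))).
  apply: nondecreasing_itv_integrable => // x y.
  rewrite !in_itv/= => x01 y01 xy; rewrite lerN2; apply: hnd;
    by rewrite ?in_itv/=; lra.
move=> /integrableN; apply: eq_integrable => // x _ /=.
by rewrite opprK.
Qed.

Lemma Rintegral_onem {R : realType} :
  \int[lebesgue_measure]_(x in `[0, 1]) (1 - x) = 2^-1 :> R.
Proof. exact: (Rintegral_onemXn 1). Qed.

Lemma Rintegral_id {R : realType} :
  \int[lebesgue_measure]_(x in `[0, 1]) x = 2^-1 :> R.
Proof.
have idI : lebesgue_measure.-integrable `[0, 1] (EFin \o @id R).
  exact: nondecreasing_itv_integrable.
have onemI := @nondecreasing_onem_integrable R id (fun x y _ _ => id).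
have := @RintegralD _ _ _ lebesgue_measure `[0, 1] id (fun x => 1 - x)
  (measurable_itv _) idI onemI.
rewrite (@eq_Rintegral _ _ _ _ _ (fun=> 1)); last by move=> x _; rewrite /= subrKC.
rewrite Rintegral_cst//= lebesgue_measure_itv/= lte01 sube0 /= Rintegral_onem.
by move=> *; lra.
Qed.

Theorem theorem3 (R : realType) (I J : set R) (h f g : R -> R) (a b : R)
  (hI : is_interval I)
  (hJ : `[0, 1] `<=` J)
  (h_superadd : superadditive_on J h)
  (h_ge0 : forall x, J x -> 0 <= h x)
  (h_ge_id : forall alpha, 0 < alpha < 1 -> alpha <= h alpha)
  (hf : SX h I f) (hg : SX h I g)
  (hfg : similarly_ordered I f g)
  (ha : I a) (hb : I b) (hab : a < b) :
  prodM f g a b / 3 + prodN f g a b / 6 <=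
    h 1 * (f a * g a * (\int[lebesgue_measure]_(alpha in `[0, 1]) h alpha)
         + f b * g b * (\int[lebesgue_measure]_(alpha in `[0, 1]) h (1 - alpha))).
Proof.
have hnd := superadditive_nondecreasing _ _ hJ h_superadd h_ge0.
have h1_ge1 : 1 <= h 1.
  have half01 : J (2^-1) by apply: hJ; rewrite /= in_itv/=; lra.
  have J1 : J (2^-1 + 2^-1) by apply: hJ; rewrite /= in_itv/=; lra.
  have := h_superadd _ _ half01 half01 J1.
  have -> : 2^-1 + 2^-1 = 1 :> R by lra.
  by have := h_ge_id 2^-1; lra.
have h_ge x : 0 <= x <= 1 -> x <= h x.
  case/andP; rewrite le_eqVlt => /predU1P[<- _|x0].
    by apply: h_ge0; apply: hJ; rewrite /= in_itv/= lexx ler01.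
  rewrite le_eqVlt => /predU1P[->//|x1].
  by apply: h_ge_id; rewrite x0.
have int_h : 2^-1 <= \int[lebesgue_measure]_(x in `[0, 1]) h x.
  rewrite -Rintegral_id; apply: le_Rintegral => //.
  - exact: (@nondecreasing_itv_integrable _ _ _ id).
  - exact: nondecreasing_itv_integrable.
have int_h1 : 2^-1 <= \int[lebesgue_measure]_(x in `[0, 1]) h (1 - x).
  rewrite -Rintegral_onem; apply: le_Rintegral => //.
  - exact: (@nondecreasing_onem_integrable _ id).
  - exact: nondecreasing_onem_integrable.
  - by move=> x /=; rewrite in_itv/= => x01; apply: h_ge; lra.
have fga : 0 <= f a * g a by rewrite mulr_ge0 ?hf.1 ?hg.1.
have fgb : 0 <= f b * g b by rewrite mulr_ge0 ?hf.1 ?hg.1.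
have NM : prodN f g a b <= prodM f g a b.
  by have := hfg a b ha hb; rewrite /prodN /prodM; lra.
apply: (@le_trans _ _ (prodM f g a b / 2)); first by lra.
have S : prodM f g a b / 2 <=
    f a * g a * (\int[lebesgue_measure]_(x in `[0, 1]) h x)
    + f b * g b * (\int[lebesgue_measure]_(x in `[0, 1]) h (1 - x)).
  by rewrite /prodM mulrDl lerD// ler_wpM2l.
apply: (le_trans S); apply: ler_peMl => //; apply: le_trans S.
by rewrite /prodM divr_ge0// addr_ge0.
Qed.
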